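(* Let $\mathcal I,\mathcal K$ be countable index sets, $T:\ell_2(\mathcal I)\to\ell_2(\mathcal K)$ a bounded linear operator with $\|T\|<1$, $g\in\ell_2(\mathcal K)$ and $r>0$. Let $1\le p\le 2$ (if $\mathcal I$ is finite, any $p\ge 1$ is allowed), where if $p=1$ it is assumed that $r\ge 1/4$. Then any global minimizer $u^*$ of $\mathcal J^p_r$ satisfies the following fixed point condition: 1. $|u^*_i|\ge\lambda'(r,p)$, if $i\in\mathcal I_1=\{j\in\mathcal I:|u^*_j|>r\}$; 2. for $p>1$: $|u^*_i|\le F_p^{-1}(\lambda'(r,p))$, if $i\in\mathcal I_0=\{j\in\mathcal I:|u^*_j|\le r\}$; 3. (a) if $p>1$: $$[T^*(g-Tu^* )]_i=\begin{cases}0,&\text{if }|u^*_i|\ge\lambda'(r,p),\\ F_p(u^*_i)-u^*_i,&\text{if }|u^*_i|\le\lambda'(r,p)-\delta(r,p);\end{cases}$$ (b) if $p=1$ and $r\ge 1/4$: $$\begin{cases}[T^*(g-Tu^* )]_i\in[-1/2,1/2],&|u^*_i|\le 1/2,\\ [T^*(g-Tu^* )]_i=\tfrac12\operatorname{sgn}(u^*_i),&1/2<|u^*_i|\le r-1/4,\\ [T^*(g-Tu^* )]_i=0,&|u^*_i|>r+1/4.\end{cases}$$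
   Context: $\mathcal J^p_r(u)=\|Tu-g\|^2_{\ell_2(\mathcal K)}+\sum_{i\in\mathcal I}\min\{|u_i|^p,r^p\}$ for $u\in\ell_2(\mathcal I)$. For $p>1$: $F_p(t)=t+\frac p2\operatorname{sgn}(t)|t|^{p-1}$, with inverse function $F_p^{-1}$; $\lambda'=\lambda'(r,p)\in(r,r+\frac p2r^{p-1})$ is the unique positive value at which $(F_p^{-1}(\lambda')-\lambda')^2+|F_p^{-1}(\lambda')|^p=r^p$; $\delta(r,p)=\lambda'(r,p)-F_p^{-1}(\lambda'(r,p))>0$. For $p=1$, $r\ge1/4$: $\lambda'(r,1)=r+1/4$. *)

(* Defs.v *)
From HB Require Import structures.
From mathcomp Require Import all_boot all_order all_algebra.
From mathcomp Require Import all_classical all_reals all_analysis.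
From mathcomp Require Import ring lra.

Set Implicit Arguments.
Unset Strict Implicit.
Unset Printing Implicit Defensive.

Import Order.TTheory GRing.Theory Num.Theory.
Import numFieldNormedType.Exports.

Local Open Scope classical_set_scope.
Local Open Scope ring_scope.

Section ell2.
Context {R : realType} {I : countType}.
Implicit Types u v : I -> R.

Definition sqsum u : \bar R := \esum_(i in [set: I]) (u i ^+ 2)%:E.

Definition sqsummable : {pred I -> R} := [pred u | `[< (sqsum u < +oo)%E >]].

Lemma sqsummableP u : reflect (sqsum u < +oo)%E (u \in sqsummable).
Proof. exact: asboolP. Qed.

Lemma sqsum_ge0 u : (0 <= sqsum u)%E.
Proof. by apply: esum_ge0 => i _; rewrite lee_fin sqr_ge0. Qed.

Lemma esumZ (c : R) (f : I -> R) : 0 <= c -> (forall i, 0 <= f i) ->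
  \esum_(i in [set: I]) (c * f i)%:E = (c%:E * \esum_(i in [set: I]) (f i)%:E)%E.
Proof.
move=> c0 f0; rewrite /esum -ereal_supZl//; last first.
  by apply/set0P; exists 0%E, set0; [exact: fsets_set0|rewrite fsbig_set0].
have E A : (c%:E * \sum_(x \in A) (f x)%:E = \sum_(x \in A) (c * f x)%:E)%E.
  by rewrite ge0_mule_fsumr// => i; rewrite lee_fin.
congr ereal_sup; apply/seteqP; split => [_ [A fA <-]|_ [_ [A fA <-] <-]].
- by exists (\sum_(x \in A) (f x)%:E)%E; [exists A|exact: E].
- by exists A => //; rewrite -E.
Qed.

Lemma sqsumZ (c : R) u : sqsum (c *: u) = ((c ^+ 2)%:E * sqsum u)%E.
Proof.
rewrite /sqsum -esumZ ?sqr_ge0//; last by move=> i; rewrite sqr_ge0.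
by apply: eq_esum => i _; rewrite -exprMn.
Qed.

(* the weighted inequality behind both closure under addition (at a = b)
   and Minkowski's inequality (at the norms of u and v) *)
Lemma sqsumD_le (a b : R) u v : 0 < a -> 0 < b ->
  (sqsum (u + v)%R <= (1 + b / a)%R%:E * sqsum u + (1 + a / b)%R%:E * sqsum v)%E.
Proof.
move=> a0 b0.
have ab0 : 0 <= b / a by rewrite divr_ge0// ltW.
have ba0 : 0 <= a / b by rewrite divr_ge0// ltW.
rewrite /sqsum -!esumZ ?addr_ge0//; try by move=> i; rewrite sqr_ge0.
rewrite -esumD; first last.
- by move=> i _; rewrite lee_fin mulr_ge0 ?addr_ge0 ?sqr_ge0.
- by move=> i _; rewrite lee_fin mulr_ge0 ?addr_ge0 ?sqr_ge0.
apply: le_esum => i _; rewrite -EFinD lee_fin -subr_ge0 fctE.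
have -> : (1 + b / a) * u i ^+ 2 + (1 + a / b) * v i ^+ 2 - (u i + v i) ^+ 2
   = (b * u i - a * v i) ^+ 2 / (a * b) by field; rewrite !gt_eqF.
by rewrite divr_ge0 ?sqr_ge0// mulr_ge0// ltW.
Qed.

Lemma sqsum0 : sqsum 0 = 0%E.
Proof. by rewrite /sqsum esum1// => i _; rewrite expr0n. Qed.

Lemma sqsummable_submod_closed : submod_closed sqsummable.
Proof.
split=> [|c u v /sqsummableP uoo /sqsummableP voo]; apply/sqsummableP.
  by rewrite sqsum0.
apply: le_lt_trans (sqsumD_le (c *: u) v ltr01 ltr01) _.
by rewrite sqsumZ lte_add_pinfty// lte_mul_pinfty ?mule_ge0 ?sqsum_ge0
  ?lee_fin ?addr_ge0 ?divr_ge0 ?sqr_ge0// lte_mul_pinfty ?lee_fin ?sqr_ge0.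
Qed.

HB.instance Definition _ :=
  GRing.isSubmodClosed.Build R (I -> R) sqsummable sqsummable_submod_closed.

End ell2.

Record ell2 (R : realType) (I : countType) := Ell2 {
  ell2_val :> I -> R ;
  _ : ell2_val \in sqsummable }.

Section ell2_normed.
Context {R : realType} {I : countType}.
Implicit Types u v : ell2 R I.

HB.instance Definition _ := [isSub for @ell2_val R I].
HB.instance Definition _ := [Choice of ell2 R I by <:].
HB.instance Definition _ := [SubChoice_isSubLmodule of ell2 R I by <:].

Definition ell2_norm u : R := Num.sqrt (fine (sqsum u)).

Lemma sqsum_fin u : sqsum u \is a fin_num.
Proof. by rewrite ge0_fin_numE ?sqsum_ge0//; exact/sqsummableP/(valP u). Qed.

Lemma ell2_norm_sqr u : ((ell2_norm u) ^+ 2)%:E = sqsum u.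
Proof.
by rewrite sqr_sqrtr ?fineK ?sqsum_fin//; apply: fine_ge0; exact: sqsum_ge0.
Qed.

Lemma ell2_norm_ge0 u : 0 <= ell2_norm u. Proof. exact: sqrtr_ge0. Qed.

Lemma le_sqsum (f : I -> R) i : ((f i ^+ 2)%:E <= sqsum f)%E.
Proof.
apply: ereal_sup_ubound; exists [set i]; first by split; [exact: finite_set1|].
by rewrite fsbig_set1.
Qed.

Lemma ell2_norm0_eq0 u : ell2_norm u = 0 -> u = 0.
Proof.
move=> u0; apply: val_inj; apply/funext => i /=.
have := le_sqsum u i; rewrite -ell2_norm_sqr u0 expr0n/= lee_fin => ui0.
by apply/eqP; rewrite -sqrf_eq0 eq_le ui0 sqr_ge0.
Qed.

Lemma ell2_normZ (c : R) u : ell2_norm (c *: u) = `|c| * ell2_norm u.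
Proof.
rewrite /ell2_norm sqsumZ fineM ?sqsum_fin//= sqrtrM ?sqr_ge0//.
by rewrite sqrtr_sqr.
Qed.

Lemma ler_ell2_normD u v : ell2_norm (u + v) <= ell2_norm u + ell2_norm v.
Proof.
have [->|u0] := eqVneq u 0.
  by rewrite add0r lerDr ell2_norm_ge0.
have [->|v0] := eqVneq v 0.
  by rewrite addr0 lerDl ell2_norm_ge0.
have a0 : 0 < ell2_norm u.
  rewrite lt_neqAle ell2_norm_ge0 andbT eq_sym.
  by apply: contra_neq u0; exact: ell2_norm0_eq0.
have b0 : 0 < ell2_norm v.
  rewrite lt_neqAle ell2_norm_ge0 andbT eq_sym.
  by apply: contra_neq v0; exact: ell2_norm0_eq0.
rewrite -ler_sqr ?nnegrE ?addr_ge0 ?ell2_norm_ge0// -lee_fin ell2_norm_sqr.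
apply: le_trans (sqsumD_le u v a0 b0) _.
rewrite -!ell2_norm_sqr -!EFinM -EFinD lee_fin le_eqVlt; apply/orP; left.
by apply/eqP; field; rewrite !gt_eqF.
Qed.

HB.instance Definition _ := Lmodule_isNormed.Build R (ell2 R I)
  ler_ell2_normD ell2_normZ ell2_norm0_eq0.

End ell2_normed.

Section dotp.
Context {R : realType} {I : countType}.
Implicit Types (f : I -> R) (u v w : ell2 R I).

(* sum of an absolutely summable real family: positive part minus negative
   part, \esum being reserved to nonnegative terms *)
Definition ssum f : R :=
  fine (\esum_(i in [set: I]) (EFin \o f)^\+ i
        - \esum_(i in [set: I]) (EFin \o f)^\- i)%E.

Definition dotp u v : R := ssum (fun i => u i * v i).

Let pos f := \esum_(i in [set: I]) (f i)%:E.

Lemma ssumE f g h : (forall i, 0 <= g i) -> (forall i, 0 <= h i) ->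
  (pos g < +oo)%E -> (pos h < +oo)%E -> (forall i, f i = g i - h i) ->
  ssum f = fine (pos g) - fine (pos h).
Proof.
move=> g0 h0 goo hoo fgh.
have S (k : I -> R) : (forall i, 0 <= k i) -> (pos k < +oo)%E ->
    summable [set: I] (EFin \o k).
  move=> k0; apply: le_lt_trans; apply: le_esum => i _ /=.
  by rewrite lee_fin ger0_norm.
have F (k : I -> R) : (forall i, 0 <= k i) -> (pos k < +oo)%E ->
    pos k \is a fin_num.
  by move=> k0 koo; rewrite ge0_fin_numE// esum_ge0// => i _; rewrite lee_fin.
rewrite -fineB; [|exact: F|exact: F].
rewrite /ssum (_ : EFin \o f = (EFin \o g) \- (EFin \o h))%E; last first.
  by apply/funext => i /=; rewrite fgh EFinB.
rewrite esumB//; [exact: S|exact: S|..] => i _ /=; rewrite lee_fin//.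
Qed.

Lemma dotpE u v : dotp u v = (`|u + v| ^+ 2 - `|u| ^+ 2 - `|v| ^+ 2) / 2.
Proof.
have E w : `|w| ^+ 2 = fine (sqsum w).
  by apply: EFin_inj; rewrite fineK ?sqsum_fin// -ell2_norm_sqr.
pose g i := 2^-1 * (u + v) i ^+ 2.
pose h i := 2^-1 * u i ^+ 2 + 2^-1 * v i ^+ 2.
have pg : pos g = (2^-1 * `|u + v| ^+ 2)%:E.
  rewrite /pos /g esumZ//; last by move=> i; rewrite sqr_ge0.
  by rewrite EFinM E fineK ?sqsum_fin.
have ph : pos h = (2^-1 * `|u| ^+ 2 + 2^-1 * `|v| ^+ 2)%:E.
  rewrite /pos /h; under eq_esum do rewrite EFinD.
  rewrite esumD; try by move=> i _; rewrite lee_fin mulr_ge0 ?sqr_ge0.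
  rewrite !esumZ//; try by move=> i; rewrite sqr_ge0.
  by rewrite !E EFinD 2!EFinM !fineK ?sqsum_fin.
rewrite /dotp (@ssumE _ g h) ?pg ?ph ?ltry//=.
- by field.
- by move=> i; rewrite /g mulr_ge0 ?sqr_ge0.
- by move=> i; rewrite /h addr_ge0// mulr_ge0 ?sqr_ge0.
- by move=> i; rewrite /g /h /= fctE; field.
Qed.

Lemma sqsumM_lt u v : (pos (fun i => `|u i * v i|%R) < +oo)%E.
Proof.
have H : (sqsum u + sqsum v < +oo)%E.
  by rewrite lte_add_pinfty// -ell2_norm_sqr ltry.
apply: le_lt_trans H; rewrite /sqsum -esumD; first last.
- by move=> i _; rewrite lee_fin sqr_ge0.
- by move=> i _; rewrite lee_fin sqr_ge0.
apply: le_esum => i _; rewrite -EFinD lee_fin normrM.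
have /= := sqr_ge0 (`|u i| - `|v i|).
rewrite sqrrB !real_normK ?num_real//.
have := normr_ge0 (u i); have := normr_ge0 (v i).
nra.
Qed.

Lemma pos_part_lt (f : I -> R) g : (forall i, `|f i| <= g i) -> (pos g < +oo)%E ->
  (pos f^\+%R < +oo)%E /\ (pos f^\-%R < +oo)%E.
Proof.
move=> fg goo; split; apply: le_lt_trans goo; apply: le_esum => i _;
  rewrite lee_fin; apply: le_trans (fg i);
  have /(congr1 (@^~ i)) /= <- := funrposDneg f; rewrite fctE ?lerDl ?lerDr//.
Qed.

Lemma dotpDl u v w : dotp (u + v) w = dotp u w + dotp v w.
Proof.
pose a i := u i * w i; pose b i := v i * w i.
have [a1 a2] := pos_part_lt (f := a) (fun=> lexx _) (sqsumM_lt u w).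
have [b1 b2] := pos_part_lt (f := b) (fun=> lexx _) (sqsumM_lt v w).
have Dp f g : (forall i, 0 <= f i) -> (forall i, 0 <= g i) ->
    pos (fun i => f i + g i) = (pos f + pos g)%E.
  by move=> f0 g0; rewrite -esumD// => i _; rewrite lee_fin.
have F f : (forall i, 0 <= f i) -> (pos f < +oo)%E -> pos f \is a fin_num.
  by move=> k0 koo; rewrite ge0_fin_numE// esum_ge0// => i _; rewrite lee_fin.
have Ep (f : I -> R) i : f i = f^\+ i - f^\- i.
  by have /(congr1 (@^~ i)) /= <- := funrposBneg f.
rewrite [dotp u w](@ssumE a a^\+ a^\-)//.
rewrite [dotp v w](@ssumE b b^\+ b^\-)//.
rewrite /dotp (@ssumE _ (fun i => a^\+ i + b^\+ i) (fun i => a^\- i + b^\- i))//.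
- rewrite !Dp// !fineD ?F//; ring.
- by move=> i; rewrite addr_ge0.
- by move=> i; rewrite addr_ge0.
- by rewrite Dp// lte_add_pinfty.
- by rewrite Dp// lte_add_pinfty.
- by move=> i; rewrite opprD addrACA -!Ep /a /b /= fctE mulrDl.
Qed.

Lemma dotpC u v : dotp u v = dotp v u.
Proof. by rewrite !dotpE (addrC u v); ring. Qed.

Lemma ler_dotp u v : dotp u v <= `|u| * `|v|.
Proof.
rewrite dotpE; have := ler_normD u v.
rewrite -ler_sqr ?nnegrE ?addr_ge0//; nra.
Qed.

Lemma dotpNl u v : dotp (- u) v = - dotp u v.
Proof.
have D0 : dotp 0 v = 0 by rewrite dotpE add0r normr0; ring.
by apply/eqP; rewrite -addr_eq0 -dotpDl addNr D0.
Qed.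

Lemma dotpZl (c : R) u v : dotp (c *: u) v = c * dotp u v.
Proof.
wlog c0 : c / 0 <= c.
  move=> H; have [|/ltW c0] := leP 0 c; first exact: H.
  by apply: oppr_inj; rewrite -dotpNl -scaleNr H ?oppr_ge0// mulNr.
pose a i := u i * v i.
have [a1 a2] := pos_part_lt (f := a) (fun=> lexx _) (sqsumM_lt u v).
have Ep (f : I -> R) i : f i = f^\+ i - f^\- i.
  by have /(congr1 (@^~ i)) /= <- := funrposBneg f.
have F f : (forall i, 0 <= f i) -> (pos f < +oo)%E -> pos f \is a fin_num.
  by move=> k0 koo; rewrite ge0_fin_numE// esum_ge0// => i _; rewrite lee_fin.
rewrite [dotp u v](@ssumE a a^\+ a^\-)//.
rewrite /dotp (@ssumE _ (fun i => c * a^\+ i) (fun i => c * a^\- i)).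
- by rewrite /pos !esumZ// !fineM ?F//= mulrBr.
- by move=> i; rewrite mulr_ge0.
- by move=> i; rewrite mulr_ge0.
- by rewrite /pos esumZ// lte_mul_pinfty.
- by rewrite /pos esumZ// lte_mul_pinfty.
- by move=> i; rewrite -mulrBr -Ep /= fctE -mulrA.
Qed.

Lemma dotpBl u v w : dotp (u - v) w = dotp u w - dotp v w.
Proof. by rewrite dotpDl dotpNl. Qed.

Lemma ler_norm_dotp u v : `|dotp u v| <= `|u| * `|v|.
Proof.
by rewrite ler_norml ler_dotp andbT lerNl -dotpNl -(normrN u) ler_dotp.
Qed.

End dotp.

Section adjoint.
Context {R : realType} {I K : countType}.

Definition opnorm (T : ell2 R I -> ell2 R K) : \bar R :=
  ereal_sup [set (`|T u|)%:E | u in [set u | `|u| <= 1]].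

(* T^* v is the vector representing the functional u |-> <T u, v>; it exists
   and is unique when T is a bounded linear operator, see adjointP *)
Definition adjoint (T : ell2 R I -> ell2 R K) (v : ell2 R K) : ell2 R I :=
  xget 0 [set w | forall u, dotp (T u) v = dotp u w].

Let e_fun (i : I) : I -> R := fun j => if j \in [set i] then 1 else 0.

Let pos1 i (c : R) : 0 <= c ->
  \esum_(j in [set: I]) (if j \in [set i] then c else 0)%:E = c%:E.
Proof.
move=> c0; rewrite -(@esum_set1 _ _ i (fun=> c%:E)) ?lee_fin//.
rewrite [RHS]esum_mkcond; apply: eq_esum => j _.
by case: ifP.
Qed.

Let e_in i : e_fun i \in sqsummable.
Proof.
apply/sqsummableP; rewrite /sqsum (_ : esum _ _ = 1%:E) ?ltry//.
rewrite -[RHS](pos1 i)//; apply: eq_esum => j _; rewrite /e_fun.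
by case: ifP; rewrite ?expr1n ?expr0n.
Qed.

Let e i : ell2 R I := Ell2 (e_in i).

Let dotpe (u : ell2 R I) i : dotp u (e i) = u i.
Proof.
pose g (c : R) j := if j \in [set i] then c else 0.
have pg c : 0 <= c -> \esum_(j in [set: I]) (g c j)%:E = c%:E.
  by move=> c0; rewrite pos1.
have m0 (c : R) : 0 <= Num.max c 0 by rewrite le_max lexx orbT.
rewrite /dotp (@ssumE _ _ _ (g (Num.max (u i) 0)) (g (Num.max (- u i) 0))).
- rewrite !pg//=; have [h|h] := leP (u i) 0.
    by rewrite max_l ?oppr_ge0// sub0r opprK.
  by rewrite max_r ?oppr_le0 ?subr0// ltW.
- by move=> j; rewrite /g; case: ifP.
- by move=> j; rewrite /g; case: ifP.
- by rewrite pg// ltry.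
- by rewrite pg// ltry.
- move=> j /=; rewrite /e_fun /g; case: ifPn => [|_]; last by rewrite mulr0 subrr.
  rewrite inE => ->; rewrite mulr1; have [h|h] := leP (u i) 0.
    by rewrite max_l ?oppr_ge0// sub0r opprK.
  by rewrite max_r ?oppr_le0 ?subr0// ltW.
Qed.

Let part (c : I -> R) (s : seq I) : ell2 R I := \sum_(i <- s) c i *: e i.

Let dotp0l (J : countType) (v : ell2 R J) : dotp 0 v = 0.
Proof. by rewrite dotpE add0r normr0; ring. Qed.

Let dotp_sum (J : countType) (c : I -> R) (f : I -> ell2 R J) s v :
  dotp (\sum_(i <- s) c i *: f i) v = \sum_(i <- s) c i * dotp (f i) v.
Proof.
elim: s => [|i s IH]; first by rewrite !big_nil dotp0l.
by rewrite !big_cons dotpDl dotpZl IH.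
Qed.

Let part_val c s j : uniq s -> j \in s -> part c s j = c j.
Proof.
move=> us js; rewrite -dotpe dotp_sum (bigD1_seq j)//=.
rewrite dotpe /= /e_fun in_set1 eqxx mulr1 big1 ?addr0// => i ij.
by rewrite dotpe /= /e_fun in_set1 eq_sym (negbTE ij) mulr0.
Qed.

Let norm2 (u : ell2 R I) : `|u| ^+ 2 = dotp u u.
Proof.
have -> : dotp u u = (`|2 *: u| ^+ 2 - `|u| ^+ 2 - `|u| ^+ 2) / 2.
  by rewrite dotpE scaler_nat mulr2n.
by rewrite normrZ ger0_norm//; field.
Qed.

Let dotp_part (u : ell2 R I) c s : dotp (part c s) u = \sum_(i <- s) c i * u i.
Proof. by rewrite dotp_sum; apply: eq_bigr => i _; rewrite dotpC dotpe. Qed.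

Let norm_part c s : uniq s -> `|part c s| ^+ 2 = \sum_(i <- s) c i ^+ 2.
Proof.
move=> us; rewrite norm2 dotp_part big_seq [RHS]big_seq.
by apply: eq_bigr => i si; rewrite part_val.
Qed.

Let norm_partB (u : ell2 R I) s : uniq s ->
  `|u - part u s| ^+ 2 = `|u| ^+ 2 - \sum_(i <- s) u i ^+ 2.
Proof.
move=> us; rewrite norm2 dotpBl (dotpC u) (dotpC (part u s)) !dotpBl.
rewrite -!norm2 norm_part// (dotpC u) dotp_part.
rewrite (eq_bigr (fun i => u i ^+ 2)); last by move=> i _; rewrite expr2.
ring.
Qed.

Let sum_seq (f : I -> R) (A : set I) : finite_set A ->
  exists2 s, uniq s & (\sum_(i \in A) (f i)%:E = (\sum_(i <- s) f i)%:E)%E.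
Proof.
move=> fA; exists (finmap.enum_fset (fset_set A)); first exact: finmap.fset_uniq.
by rewrite fsbig_finite// sumEFin.
Qed.

Lemma adjointP (T : {linear ell2 R I -> ell2 R K}) :
    bounded_near T (nbhs (0 : ell2 R I)) ->
  forall u v, dotp (T u) v = dotp u (adjoint T v).
Proof.
move=> /linear_boundedP/pinfty_ex_gt0[M M0 TM] u v; move: u.
pose c i := dotp (T (e i)) v.
have Tpart a s : dotp (T (part a s)) v = \sum_(i <- s) a i * c i.
  rewrite /part linear_sum -dotp_sum; congr dotp.
  by apply: eq_bigr => i _; rewrite linearZ.
have c_in : c \in sqsummable.
  apply/sqsummableP; apply: (@le_lt_trans _ _ ((M * `|v|) ^+ 2)%:E); last first.
    by rewrite ltry.
  apply: ge_ereal_sup => _ [A [fA _] <-].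
  have [s us ->] := sum_seq (fun i => c i ^+ 2) fA.
  rewrite lee_fin -norm_part//.
  have H : `|part c s| ^+ 2 <= M * `|v| * `|part c s|.
    rewrite norm_part// (eq_bigr (fun i => c i * c i)); last first.
      by move=> i _; rewrite expr2.
    rewrite -Tpart (le_trans (ler_dotp _ _))// mulrAC ler_wpM2r//.
  rewrite ler_sqr ?nnegrE ?mulr_ge0 ?(ltW M0)//.
  have [->|p0] := eqVneq (part c s) 0; first by rewrite normr0 mulr_ge0 ?(ltW M0).
  by move: H; rewrite expr2 ler_pM2r// normr_gt0.
pose w := Ell2 c_in.
suff : [set w | forall u, dotp (T u) v = dotp u w] w.
  by move=> /(@xgetI _ 0).
move=> u /=; apply/eqP; rewrite -subr_eq0; apply/negPn/negP => phi0.
pose phi x := dotp (T x) v - dotp x w.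
pose C := M * `|v| + `|w| + 1.
have C0 : 0 < C by rewrite ltr_wpDl// addr_ge0// mulr_ge0// ltW.
have phiC x : `|phi x| <= C * `|x|.
  rewrite (le_trans (ler_normB _ _))// /C 2!mulrDl.
  rewrite -[leLHS]addr0 lerD ?mul1r// lerD//.
    by rewrite (le_trans (ler_norm_dotp _ _))// mulrAC ler_wpM2r.
  by rewrite (le_trans (ler_norm_dotp _ _))// mulrC.
have p2 : 0 < (`|phi u| / C) ^+ 2.
  by rewrite exprn_gt0// divr_gt0// normr_gt0.
have /(ub_ereal_sup_adherent p2)[_ [A [fA _] <-]] := sqsum_fin u.
have [s us ->] := sum_seq (fun i => u i ^+ 2) fA.
rewrite -/(esum _ _) -/(sqsum u) -ell2_norm_sqr -EFinB lte_fin.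
rewrite ltrBlDr -ltrBlDl -[ell2_norm u]/(`|u|) -norm_partB//.
apply/negP; rewrite -leNgt ler_sqr ?nnegrE ?divr_ge0 ?(ltW C0)//.
rewrite ler_pdivrMr// mulrC.
suff -> : phi u = phi (u - part u s) by [].
rewrite /phi linearB !dotpBl Tpart dotp_part/=; ring.
Qed.

End adjoint.

Section thresholds.
Context {R : realType}.
Implicit Types p r t y l : R.

Definition Fp p t : R := t + p / 2 * Num.sg t * `|t| `^ (p - 1).

Definition Fp_inv p : R -> R := 'pinv_(fun=> 0) [set: R] (Fp p).

Definition lambda_eq r p l :=
  (Fp_inv p l - l) ^+ 2 + `|Fp_inv p l| `^ p = r `^ p.

(* the value at p = 1 is only meaningful for 1/4 <= r; for p > 1 see lambdaP *)
Definition lambda r p : R :=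
  if p == 1 then r + 1 / 4 else xget 0 [set l | 0 < l /\ lambda_eq r p l].

Definition delta r p : R := lambda r p - Fp_inv p (lambda r p).

Lemma powR_within_continuous q b : 0 < q -> 0 < b ->
  {within `[0, b], continuous (@powR R ^~ q)}.
Proof.
move=> q0 b0.
have C x : 0 < x -> {for x, continuous (@powR R ^~ q)}.
  move=> x0; apply: differentiable_continuous; apply/derivable1_diffP.
  by apply: derivable_powR; rewrite in_itv/= x0.
apply/continuous_within_itvP => //; split.
- by move=> x; rewrite in_itv/= => /andP[x0 _]; exact: C.
- by rewrite powR0 ?gt_eqF//; exact: powR_cvg0.
- by apply: cvg_at_left_filter; exact: C.
Qed.

Lemma Fp_ge0E p t : 1 < p -> 0 <= t -> Fp p t = t + p / 2 * t `^ (p - 1).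
Proof.
move=> p1; rewrite le_eqVlt => /predU1P[<-|t0].
  by rewrite /Fp normr0 powR0 ?mulr0// subr_eq0 gt_eqF.
by rewrite /Fp gtr0_sg// mulr1 gtr0_norm.
Qed.

Lemma FpN p t : Fp p (- t) = - Fp p t.
Proof. by rewrite /Fp sgrN normrN; ring. Qed.

Lemma Fp0 p : Fp p 0 = 0.
Proof. by rewrite /Fp sgr0 mulr0 mul0r addr0. Qed.

Lemma Fp_ltr p : 1 < p -> {homo Fp p : s t / s < t}.
Proof.
move=> p1; have M s t : 0 <= s -> s < t -> Fp p s < Fp p t.
  move=> s0 st; have t0 : 0 <= t by rewrite (le_trans s0)// ltW.
  rewrite !Fp_ge0E// ltr_leD// ler_wpM2l// ?divr_ge0//; first by lra.
  by rewrite ge0_ler_powR ?nnegrE ?subr_ge0 ?(ltW p1) ?(ltW st).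
move=> s t st; have [s0|s0] := leP 0 s; first exact: M.
have [t0|t0] := leP 0 t.
  have a : Fp p s < 0 by rewrite -oppr_gt0 -FpN -[ltLHS](Fp0 p) M ?oppr_gt0.
  apply: lt_le_trans a _; move: t0; rewrite le_eqVlt => /predU1P[<-|t0].
    by rewrite Fp0.
  by rewrite -[leLHS](Fp0 p) ltW// M.
by rewrite -ltrN2 -!FpN M ?ltrN2// oppr_ge0 ltW.
Qed.

Lemma Fp_inj p : 1 < p -> injective (Fp p).
Proof.
move=> p1 s t st; case: (ltgtP s t) => // /(Fp_ltr p1); by rewrite st ltxx.
Qed.

Lemma Fp_surj p y : 1 < p -> exists t, Fp p t = y.
Proof.
move=> p1; wlog y0 : y / 0 < y.
  move=> H; have [y0|y0|<-] := ltgtP 0 y; first exact: H.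
    have [|t ty] := H (- y); first by rewrite oppr_gt0.
    by exists (- t); rewrite FpN ty opprK.
  by exists 0; rewrite Fp0.
have C : {within `[0, y], continuous (fun t => t + p / 2 * t `^ (p - 1))}.
  move=> x; apply: cvgD; first by apply: continuous_subspaceT => z; exact: cvg_id.
  by apply: cvgMr; apply: powR_within_continuous; rewrite ?subr_gt0.
have p2 : 0 <= p / 2 by rewrite divr_ge0//; lra.
have [|t] := IVT (ltW y0) C (v := y).
  rewrite powR0 ?subr_eq0 ?gt_eqF// mulr0 addr0 ge_min ltW//= le_max.
  by rewrite lerDl mulr_ge0 ?powR_ge0 ?orbT.
by rewrite in_itv/= => /andP[t0 _] ty; exists t; rewrite Fp_ge0E.
Qed.

Lemma FpK p : 1 < p -> cancel (Fp p) (Fp_inv p).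
Proof.
by move=> p1 t; apply: pinvKV; rewrite ?inE// => s {}t _ _; exact: Fp_inj.
Qed.

Lemma Fp_invK p : 1 < p -> cancel (Fp_inv p) (Fp p).
Proof. by move=> p1 y; have [t <-] := Fp_surj y p1; rewrite FpK. Qed.

Lemma lambdaP r p : 0 < r -> 1 < p ->
  [/\ r < lambda r p < r + p / 2 * r `^ (p - 1),
      lambda_eq r p (lambda r p),
      forall l, 0 < l -> lambda_eq r p l -> l = lambda r p &
      0 < delta r p].
Proof.
move=> r0 p1; pose G t := (p / 2 * t `^ (p - 1)) ^+ 2 + t `^ p.
have p0 : 0 < p by lra.
have p2 : 0 < p / 2 by rewrite divr_gt0.
have q0 : 0 < p - 1 by lra.
have Geq t : 0 <= t -> lambda_eq r p (Fp p t) <-> G t = r `^ p.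
  move=> t0; rewrite /lambda_eq FpK// Fp_ge0E// ger0_norm//.
  by rewrite opprD addrA subrr sub0r sqrrN.
have Glt s t : 0 <= s -> s < t -> G s < G t.
  move=> s0 st; have t0 := le_lt_trans s0 st.
  rewrite ler_ltD ?gt0_ltr_powR ?nnegrE ?(ltW t0)//.
  rewrite ler_sqr ?nnegrE ?mulr_ge0 ?powR_ge0 ?(ltW p0) ?(ltW p2)// ler_wpM2l ?(ltW p2)//.
  by rewrite ge0_ler_powR ?nnegrE ?(ltW q0) ?(ltW t0) ?(ltW st).
have C : {within `[0, r], continuous G}.
  move=> x; apply: cvgD; last exact: powR_within_continuous.
  apply: cvgM; apply: cvgMr; exact: powR_within_continuous.
have rq : 0 < p / 2 * r `^ (p - 1) by rewrite mulr_gt0// powR_gt0.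
have rp : 0 < r `^ p by rewrite powR_gt0.
have G0 : G 0 = 0 by rewrite /G !powR0 ?gt_eqF// mulr0 expr0n addr0.
have Gr : r `^ p < G r by rewrite /G ltrDr exprn_gt0.
have [|t] := IVT (ltW r0) C (v := r `^ p).
  by rewrite G0 ge_min (ltW rp)/= le_max (ltW Gr) orbT.
rewrite in_itv/= => /andP[t0 tr] Gt.
have {}t0 : 0 < t.
  rewrite lt_neqAle t0 andbT; apply/eqP => t00; move: rp.
  by rewrite -Gt -t00 G0 ltxx.
have {}tr : t < r.
  rewrite lt_neqAle tr andbT; apply/eqP => trr; move: Gr.
  by rewrite -trr Gt trr ltxx.
have l0 : 0 < Fp p t by rewrite -(Fp0 p); exact: Fp_ltr.
have U l : 0 < l -> lambda_eq r p l -> l = Fp p t.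
  move=> lgt0; rewrite -[l](Fp_invK p1).
  have s0 : 0 < Fp_inv p l.
    rewrite ltNge; apply/negP; rewrite le_eqVlt => /predU1P[s0|/(Fp_ltr p1)].
      by move: lgt0; rewrite -[l](Fp_invK p1) s0 Fp0 ltxx.
    by rewrite Fp_invK// Fp0 => /(lt_trans lgt0); rewrite ltxx.
  move=> /(Geq _ (ltW s0)) Gs; congr Fp.
  case: (ltgtP (Fp_inv p l) t) => // /Glt.
    by move=> /(_ (ltW s0)); rewrite Gs Gt ltxx.
  by move=> /(_ (ltW t0)); rewrite Gs Gt ltxx.
have lE : lambda r p = Fp p t.
  rewrite /lambda gt_eqF//; apply: xget_unique.
    by split => //; apply/(Geq _ (ltW t0)).
  by move=> l [lgt0 ll]; exact: U.
rewrite /delta lE FpK//; split => //; last 2 first.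
- by apply/(Geq _ (ltW t0)).
- by rewrite Fp_ge0E ?(ltW t0)// addrAC subrr add0r mulr_gt0// powR_gt0.
apply/andP; split; last by rewrite -Fp_ge0E ?(ltW r0)//; exact: Fp_ltr.
rewrite Fp_ge0E ?(ltW t0)//; set h := p / 2 * _.
have h0 : 0 < h by rewrite mulr_gt0// powR_gt0.
have [|x||c] := @MVT _ (@powR R ^~ p) (fun c => p * c `^ (p - 1)) t (t + h).
- by rewrite ltrDl.
- rewrite in_itv/= => /andP[tx _].
  have x0 : x \in `]0, +oo[ by rewrite in_itv/= (lt_trans t0).
  apply: DeriveDef; first exact: derivable_powR.
  by rewrite -derive1E powR_derive1.
- apply: (continuous_subspaceW _ (powR_within_continuous p0 (addr_gt0 t0 h0))).
  by move=> z /=; rewrite !in_itv/= => /andP[tz ->]; rewrite (le_trans (ltW t0) tz).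
rewrite in_itv/= => /andP[tc _] E.
rewrite ltNge; apply/negP => thr.
have : (t + h) `^ p <= r `^ p.
  by rewrite ge0_ler_powR ?nnegrE ?(ltW p0)// ?(ltW r0)// addr_ge0// ltW.
rewrite -Gt /G -/h; have : t `^ (p - 1) <= c `^ (p - 1).
  by rewrite ge0_ler_powR ?nnegrE ?ltW// (lt_trans t0).
have hE : p * t `^ (p - 1) = 2 * h by rewrite /h; field.
rewrite -(ler_pM2l p0) hE => hc.
have htE : t + h - t = h by ring.
rewrite htE in E; rewrite -[(t + h) `^ p](subrK (t `^ p)) E lerD2r => H.
have : 2 * h * h <= h ^+ 2 by rewrite (le_trans _ H)// ler_pM2r.
nra.
Qed.

End thresholds.

Definition Jpr {R : realType} {I K : countType} (T : ell2 R I -> ell2 R K)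
    (g : ell2 R K) (p r : R) (u : ell2 R I) : \bar R :=
  ((`|T u - g| ^+ 2)%:E +
   \esum_(i in [set: I]) (Num.min (`|u i| `^ p) (r `^ p))%:E)%E.

(* Main.v *)
(** Moving a minimizer [u] along a basis vector [e_i] changes the fidelity term
    by [- 2 h c + h^2 |T e_i|^2 <= - 2 h c + h^2], where [c] is the [i]-th
    coordinate of [T^* (g - T u)].  Hence [x = u_i] minimizes the scalar
    function [y |-> (y - z)^2 + min(|y|^p, r^p)] with [z = x + c].  If
    [|x| >= r], comparison with [y = z] gives [z = x]; if [|x| <= r], then [x]
    also minimizes [(y - z)^2 + |y|^p], and Fermat's rule gives [z = F_p(x)].
    The gap between [F_p^-1(lambda')] and [lambda'] comes from comparing with
    [y = F_p^-1(lambda')] (with [y = r - 1/4] when [p = 1]) in the first case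
    and with [y = z] in the second. *)
Require Import Defs.
From HB Require Import structures.
From mathcomp Require Import all_boot all_order all_algebra.
From mathcomp Require Import all_classical all_reals all_analysis.
From mathcomp Require Import ring lra.

Set Implicit Arguments.
Unset Strict Implicit.
Unset Printing Implicit Defensive.

Import Order.TTheory GRing.Theory Num.Theory.
Import numFieldNormedType.Exports.

Local Open Scope classical_set_scope.
Local Open Scope ring_scope.

(** * Scalar proximal problem for the power penalty and its truncation *)

Section scalar_prox.
Context {R : realType}.
Implicit Types (p r z x y t l : R) (phi : R -> R).

(** [x] is a value at [z] of the possibly multivalued proximal map of [phi]. *)
Definition prox_point phi z x :=
  forall y, (x - z) ^+ 2 + phi x <= (y - z) ^+ 2 + phi y.

Lemma prox_pointN phi z x : (forall y, phi (- y) = phi y) ->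
  prox_point phi z x -> prox_point phi (- z) (- x).
Proof.
move=> phiN zx y; have := zx (- y); rewrite !phiN.
have -> : (- x - - z) ^+ 2 = (x - z) ^+ 2 by ring.
by have -> : (- y - z) ^+ 2 = (y - - z) ^+ 2 by ring.
Qed.

Definition trunc_pow p r y : R := Num.min (`|y| `^ p) (r `^ p).

Lemma trunc_powN p r y : trunc_pow p r (- y) = trunc_pow p r y.
Proof. by rewrite /trunc_pow normrN. Qed.

Lemma trunc_pow_ge0 p r y : 0 <= trunc_pow p r y.
Proof. by rewrite le_min !powR_ge0. Qed.

(** On the positive axis the objective is differentiable, so its derivative [2 (x - z) + p x^(p-1)]
    vanishes at [x]. *)
Lemma prox_pow_gt0 p z x : 0 < x -> prox_point (fun y => `|y| `^ p) z x ->
  z = Fp p x.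
Proof.
move=> x0 zx; pose f y := (y - z) ^+ 2 + y `^ p.
have D y : 0 < y -> is_derive y 1 f (2 * (y - z) + p * y `^ (p - 1)).
  move=> y0; have yI : y \in `]0, +oo[ by rewrite in_itv/= y0.
  have Dp : is_derive y 1 (@powR R ^~ p) (p * y `^ (p - 1)).
    apply: DeriveDef; first exact: derivable_powR.
    by rewrite -derive1E powR_derive1.
  have Dq : is_derive y 1 (fun y => (y - z) ^+ 2) (2 * (y - z)).
    by apply: is_derive_eq; rewrite /GRing.scale/=; ring.
  exact: is_deriveD.
have [||||_ E] := @derive1_at_min _ f 0 (2 * x) x.
- by lra.
- by move=> y; rewrite in_itv/= => /andP[/D[]].
- by rewrite in_itv/=; lra.
- move=> y; rewrite in_itv/= => /andP[y0 _].
  by have := zx y; rewrite /f !gtr0_norm.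
have [_] := D _ x0; rewrite E => E'.
by rewrite /Fp gtr0_sg// gtr0_norm//; lra.
Qed.

Lemma prox_pow_neq0 p z x : x != 0 -> prox_point (fun y => `|y| `^ p) z x ->
  z = Fp p x.
Proof.
move=> x0 zx; have [xlt0|xgt0|x00] := ltgtP x 0.
- apply: oppr_inj; rewrite -FpN; apply: prox_pow_gt0; first by rewrite oppr_gt0.
  by apply: prox_pointN => // y; rewrite normrN.
- exact: prox_pow_gt0.
- by rewrite x00 eqxx in x0.
Qed.

(** Comparison of [0] with a competitor [y] of the same sign as [z], divided by [y]. Letting [y]
    tend to [0] gives [z = 0] when [p > 1] and [|z| <= 1/2] when [p = 1]. *)
Lemma prox_pow_at0 p z y : 1 <= p -> 0 < y ->
  prox_point (fun y => `|y| `^ p) z 0 -> 2 * `|z| <= y + y `^ (p - 1).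
Proof.
move=> p1 y0; wlog z0 : z / 0 <= z.
  move=> H z0; have [/H|/ltW] := leP 0 z; first exact.
  rewrite -oppr_ge0 => /H; rewrite normrN; apply.
  by rewrite -oppr0; apply: prox_pointN => // t; rewrite normrN.
move=> /(_ y); rewrite normr0 powR0 ?gt_eqF//; last by lra.
rewrite (gtr0_norm y0) (ger0_norm z0).
have -> : y `^ p = y * y `^ (p - 1) by rewrite mulr_powRB1//; lra.
move=> H; rewrite -(ler_pM2l y0); lra.
Qed.

Lemma prox_pow p z x : 1 < p -> prox_point (fun y => `|y| `^ p) z x ->
  z = Fp p x.
Proof.
move=> p1; have [->|x0] := eqVneq x 0; last exact: prox_pow_neq0.
rewrite Fp0 => z0; apply/eqP; apply/negPn/negP; rewrite -normr_gt0 => nz.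
(* With [y = min a b], both [y] and [y^(p-1)] are at most [|z| / 2], so [2 |z| <= |z|], which is
   absurd. *)
pose a := `|z| / 2; have a0 : 0 < a by rewrite divr_gt0.
pose b := a `^ (p - 1)^-1; have b0 : 0 < b by rewrite powR_gt0.
have m0 : 0 < Num.min a b by rewrite lt_min a0.
have : Num.min a b `^ (p - 1) <= a.
  have bE : b `^ (p - 1) = a.
    by rewrite -powRrM mulVf ?powRr1 ?ltW// subr_eq0 gt_eqF.
  rewrite -[X in _ <= X]bE ge0_ler_powR ?nnegrE ?subr_ge0 ?(ltW p1) ?(ltW m0)//.
    exact: ltW.
  by rewrite ge_min lexx orbT.
have : Num.min a b <= a by rewrite ge_min lexx.
have := prox_pow_at0 (ltW p1) m0 z0; rewrite /a; lra.
Qed.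

(** Truncation is inactive at [x] and only lowers the cost of competitors, so optimality passes to
    the plain power. *)
Lemma prox_trunc_pow_le p r z x : 0 <= p -> `|x| <= r ->
  prox_point (trunc_pow p r) z x -> prox_point (fun y => `|y| `^ p) z x.
Proof.
move=> p0 xr zx y; have := zx y.
rewrite {1}/trunc_pow min_l ?ge0_ler_powR ?nnegrE//; last first.
  exact: le_trans (normr_ge0 _) xr.
by move=> /le_trans; apply; rewrite lerD2l ge_min lexx.
Qed.

(** The penalty at [x] already has its maximal value [r^p], so moving to [z] cannot raise it and
    removes the quadratic term. *)
Lemma prox_trunc_pow_ge p r z x : 0 <= p -> 0 <= r -> r <= `|x| ->
  prox_point (trunc_pow p r) z x -> z = x.
Proof.
move=> p0 r0 rx /(_ z).
rewrite {1}/trunc_pow min_r ?ge0_ler_powR ?nnegrE// subrr expr0n/= add0r => H.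
have : (x - z) ^+ 2 <= 0.
  by rewrite -(lerD2r (r `^ p)) add0r (le_trans H)// ge_min lexx orbT.
by move=> H0; apply/eqP; rewrite eq_sym -subr_eq0 -sqrf_eq0 eq_le H0 sqr_ge0.
Qed.

(** Any solution [(t, l)] of the threshold equation is allowed, to serve both [p = 1] and [p > 1].
    Up to sign [z = x > t], and the competitor [t] gives [(t - l)^2 <= (t - x)^2], hence
    [l <= x]. *)
Lemma prox_trunc_pow_gap p r z x t l : 0 <= p -> 0 <= t -> t <= r ->
  (t - l) ^+ 2 + t `^ p = r `^ p -> r < `|x| ->
  prox_point (trunc_pow p r) z x -> l <= `|x|.
Proof.
move=> p0 t0 tr E rx zx; have r0 : 0 <= r := le_trans t0 tr.
wlog x0 : z x rx zx / 0 <= x.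
  move=> H; have [/H|/ltW x0] := leP 0 x; first by apply; eassumption.
  rewrite -normrN; apply: (H (- z)); rewrite ?normrN ?oppr_ge0//.
  by apply: prox_pointN zx => y; rewrite trunc_powN.
rewrite ger0_norm// in rx *.
have zE : z = x by apply: (prox_trunc_pow_ge p0 r0 _ zx); rewrite ger0_norm// ltW.
have := zx t; rewrite zE subrr expr0n/= add0r {1}/trunc_pow.
rewrite (ger0_norm x0) min_r ?ge0_ler_powR ?nnegrE ?(ltW rx)// => H.
have {H} : r `^ p <= (t - x) ^+ 2 + t `^ p.
  by rewrite (le_trans H)// lerD2l ge_min ger0_norm// lexx.
by rewrite -E lerD2r; nra.
Qed.

End scalar_prox.

(** * The gap below [lambda'] for [p > 1] *)

Section lambda_gap.
Context {R : realType}.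
Variables (p r : R).
Hypotheses (p1 : 1 < p) (r0 : 0 < r).

Let p_gt0 : 0 < p. Proof. exact: lt_trans ltr01 p1. Qed.

Let l := lambda r p.
Let t := Fp_inv p l.

Lemma Fp_inv_lambda_gt0 : 0 < t.
Proof.
have [/andP[rl _] _ _ _] := lambdaP r0 p1.
rewrite ltNge; apply/negP => t0; have l0 := lt_trans r0 rl.
have : Fp p t <= Fp p 0.
  by move: t0; rewrite le_eqVlt => /predU1P[->|/(Fp_ltr p1)/ltW].
by rewrite Fp_invK// Fp0 leNgt l0.
Qed.

Lemma lambda_eqE : (t - l) ^+ 2 + t `^ p = r `^ p.
Proof.
have [_ + _ _] := lambdaP r0 p1; rewrite /lambda_eq ger0_norm//.
exact/ltW/Fp_inv_lambda_gt0.
Qed.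

(** The squared gap in the equation defining [lambda'] is positive, which leaves [t^p < r^p]. *)
Lemma Fp_inv_lambda_lt : t < r.
Proof.
have t0 := Fp_inv_lambda_gt0; have [_ _ _ d0] := lambdaP r0 p1.
have : t `^ p < r `^ p.
  by rewrite -lambda_eqE ltrDr -sqrrN opprB exprn_gt0.
have p0 := ltW p_gt0.
apply: contraTT; rewrite -!leNgt => rt.
by rewrite ge0_ler_powR ?nnegrE ?(ltW r0) ?(ltW t0).
Qed.

Lemma prox_trunc_pow_le_inv z x : `|x| <= r ->
  prox_point (trunc_pow p r) z x -> `|x| <= t.
Proof.
wlog x0 : z x / 0 <= x.
  move=> H; have [/H|/ltW x0] := leP 0 x; first by apply; eassumption.
  rewrite -normrN => xr zx; apply: (H (- z)); rewrite ?oppr_ge0//.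
  by apply: prox_pointN zx => y; rewrite trunc_powN.
rewrite (ger0_norm x0) => xr zx; have p0 := ltW p_gt0.
have t0 := Fp_inv_lambda_gt0; have r0' := ltW r0.
have zE : z = Fp p x.
  by apply: prox_pow => //; apply: prox_trunc_pow_le zx; rewrite ?ger0_norm.
(* Both sides are values of [s |-> (F_p(s) - s)^2 + s^p], strictly increasing for [s >= 0]. The
   right one is [r^p]; the left one is the cost of [x], at most the cost of the competitor
   [z = F_p(x)]. *)
have G : (p / 2 * x `^ (p - 1)) ^+ 2 + x `^ p <=
         (p / 2 * t `^ (p - 1)) ^+ 2 + t `^ p.
  have -> : p / 2 * t `^ (p - 1) = l - t.
    by rewrite -{1}[l](Fp_invK p1) -/t Fp_ge0E ?(ltW t0)// addrAC subrr add0r.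
  rewrite -[X in _ <= X + _]sqrrN opprB lambda_eqE.
  have -> : (p / 2 * x `^ (p - 1)) ^+ 2 = (x - z) ^+ 2.
    by rewrite zE Fp_ge0E//; ring.
  have := zx z; rewrite subrr expr0n/= add0r {1}/trunc_pow (ger0_norm x0).
  rewrite min_l ?ge0_ler_powR ?nnegrE//.
  by move=> /le_trans; apply; rewrite ge_min lexx orbT.
rewrite leNgt; apply/negP => tx; move: G; apply/negP; rewrite -ltNge.
rewrite ler_ltD ?gt0_ltr_powR ?nnegrE ?(ltW t0)//.
rewrite ler_sqr ?nnegrE ?mulr_ge0 ?powR_ge0 ?invr_ge0// ler_wpM2l ?mulr_ge0 ?invr_ge0//.
by rewrite ge0_ler_powR ?nnegrE ?(ltW tx) ?(ltW t0)// subr_ge0 ltW.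
Qed.

End lambda_gap.

(** * Isolating one coordinate and standard basis vectors in [ell2] *)

Lemma esum_splitD1 {R : realType} {I : choiceType} (f : I -> R) (i : I) :
  (forall j, 0 <= f j) ->
  \esum_(j in [set: I]) (f j)%:E =
  ((f i)%:E + \esum_(j in ~` [set i]) (f j)%:E)%E.
Proof.
move=> f0; rewrite (esumID [set i]); last by move=> j _; rewrite lee_fin.
by rewrite !setTI esum_set1 ?lee_fin.
Qed.

Section ell2_basis.
Context {R : realType} {I : countType}.
Implicit Types (u v : ell2 R I) (i j : I).

Lemma ell2_addE u v i : (u + v) i = u i + v i. Proof. by []. Qed.

Lemma ell2_scaleE (c : R) u i : (c *: u) i = c * u i. Proof. by []. Qed.

Lemma sqsum_delta i : sqsum (fun j => (j == i)%:R : R) = 1%E.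
Proof.
rewrite /sqsum (esum_splitD1 i) ?eqxx ?expr1n; last by move=> j; exact: sqr_ge0.
rewrite esum1 ?adde0// => j /= /eqP/negPf ->.
by rewrite expr0n.
Qed.

Lemma delta_sqsummable i : (fun j => (j == i)%:R : R) \in sqsummable.
Proof. by apply/sqsummableP; rewrite sqsum_delta ltry. Qed.

Definition ell2_delta i : ell2 R I := Ell2 (delta_sqsummable i).

Lemma ell2_deltaE i j : ell2_delta i j = (j == i)%:R. Proof. by []. Qed.

Lemma norm_ell2_delta i : `|ell2_delta i| = 1.
Proof. by rewrite /Num.norm/= /ell2_norm sqsum_delta/= sqrtr1. Qed.

Lemma norm_ell2_addr_delta u i :
  `|u + ell2_delta i| ^+ 2 = `|u| ^+ 2 + 2 * u i + 1.
Proof.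
apply: EFin_inj; rewrite 2!EFinD [LHS]ell2_norm_sqr [in RHS]ell2_norm_sqr.
rewrite /sqsum !(esum_splitD1 i); try by move=> j; exact: sqr_ge0.
rewrite ell2_addE ell2_deltaE eqxx.
rewrite (@eq_esum _ _ _ _ (fun j => (u j ^+ 2)%:E)); last first.
  by move=> j ji; rewrite ell2_addE ell2_deltaE (introF eqP ji) addr0.
have -> : (u i + 1%:R) ^+ 2 = u i ^+ 2 + (2 * u i + 1) by ring.
by rewrite EFinD -!addeA; congr adde; rewrite addeC EFinD.
Qed.

Lemma dotp_delta u i : dotp (ell2_delta i) u = u i.
Proof.
by rewrite dotpC dotpE norm_ell2_addr_delta norm_ell2_delta; field.
Qed.

Lemma norm_ell2_addr u v : `|u + v| ^+ 2 = `|u| ^+ 2 + 2 * dotp v u + `|v| ^+ 2.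
Proof. by rewrite dotpC dotpE; field. Qed.

End ell2_basis.

(** * Reduction of the minimization to single coordinates *)

Section coordinate_perturbation.
Context {R : realType} {I K : countType}.
Variables (T : {linear ell2 R I -> ell2 R K}) (g : ell2 R K) (r p : R).
Hypotheses (Tbounded : bounded_near T (nbhs (0 : ell2 R I)))
  (Tnorm : (opnorm T <= 1)%E) (p_gt0 : 0 < p).
Variable ustar : ell2 R I.
Hypothesis ustar_min : forall u, (Jpr T g p r ustar <= Jpr T g p r u)%E.

Lemma norm_delta_le1 i : `|T (ell2_delta i)| <= 1.
Proof.
rewrite -lee_fin; apply: le_trans Tnorm; apply: ereal_sup_ubound.
by exists (ell2_delta i) => //=; rewrite norm_ell2_delta.
Qed.

(** Comparison with the zero vector; finiteness allows the cancellation of the penalty off one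
    coordinate. *)
Lemma Jpr_min_fin : (Jpr T g p r ustar < +oo)%E.
Proof.
apply: le_lt_trans (ustar_min 0) _.
rewrite /Jpr esum1 ?adde0 ?ltry// => i _ /=.
by rewrite normr0 powR0 ?gt_eqF// min_l ?powR_ge0.
Qed.

Lemma min_coord_prox i :
  prox_point (trunc_pow p r) (ustar i + adjoint T (g - T ustar) i) (ustar i).
Proof.
move=> y; pose h := y - ustar i; pose e := ell2_delta i : ell2 R I.
have Te : `|h *: T e| ^+ 2 <= h ^+ 2.
  rewrite normrZ exprMn real_normK ?num_real//.
  by rewrite ler_piMr ?sqr_ge0// exprn_ile1 ?norm_delta_le1.
have res : adjoint T (g - T ustar) i = - dotp (T e) (T ustar - g).
  by rewrite -dotp_delta -adjointP// dotpC -opprB dotpNl dotpC.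
have Q : `|T (ustar + h *: e) - g| ^+ 2 <=
    `|T ustar - g| ^+ 2 - 2 * h * adjoint T (g - T ustar) i + h ^+ 2.
  rewrite linearD linearZ/= addrAC norm_ell2_addr dotpZl res.
  by rewrite mulrN opprK mulrA lerD2l.
move: Q; have := Jpr_min_fin; have := ustar_min (ustar + h *: e).
rewrite /Jpr !(esum_splitD1 i (fun j => trunc_pow_ge0 p r _)).
rewrite (@eq_esum _ _ (~` [set i]) (fun j => (trunc_pow p r ((ustar + h *: e) j))%:E)
   (fun j => (trunc_pow p r (ustar j))%:E)); last first.
  by move=> j ji; rewrite ell2_addE ell2_scaleE ell2_deltaE (introF eqP ji) mulr0 addr0.
have -> : (ustar + h *: e) i = y.
  by rewrite ell2_addE ell2_scaleE ell2_deltaE eqxx mulr1 /h addrC subrK.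
set S := esum _ _; have : (0 <= S)%E.
  by apply: esum_ge0 => j _; rewrite lee_fin trunc_pow_ge0.
rewrite -/(trunc_pow p r y) -/(trunc_pow p r (ustar i)) /h; move: S.
move: (`|T ustar - g| ^+ 2) (`|T (ustar + _) - g| ^+ 2) => A B.
move: (trunc_pow p r y) (trunc_pow p r (ustar i)) => a b.
(* [S] is the penalty off [i], common to both vectors: [-oo] contradicts its sign and [+oo] the
   finiteness of the minimum, so it cancels as a real. *)
by case=> [s _| |]//=; rewrite ?addeA// -!EFinD lee_fin => ? _ ?; lra.
Qed.

End coordinate_perturbation.

(** * The fixed point conditions, coordinate by coordinate *)

Theorem theorem4p2 (R : realType) (I K : countType)
    (T : {linear ell2 R I -> ell2 R K}) (g : ell2 R K) (r p : R)
    (Tbounded : bounded_near T (nbhs (0 : ell2 R I)))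
    (Tnorm : (opnorm T < 1)%E)
    (r_gt0 : 0 < r) (p_ge1 : 1 <= p)
    (p_le2 : p <= 2 \/ finite_set [set: I])
    (r_ge14 : p = 1 -> 1 / 4 <= r)
    (ustar : ell2 R I)
    (ustar_min : forall u : ell2 R I, (Jpr T g p r ustar <= Jpr T g p r u)%E) :
  let res := adjoint T (g - T ustar) in
  [/\ forall i, r < `|ustar i| -> lambda r p <= `|ustar i|,
      1 < p -> forall i, `|ustar i| <= r ->
        `|ustar i| <= Fp_inv p (lambda r p),
      1 < p -> forall i,
        (lambda r p <= `|ustar i| -> res i = 0) /\
        (`|ustar i| <= lambda r p - delta r p ->
           res i = Fp p (ustar i) - ustar i) &
      p = 1 -> forall i,
        [/\ `|ustar i| <= 1 / 2 -> - (1 / 2) <= res i <= 1 / 2,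
            1 / 2 < `|ustar i| <= r - 1 / 4 ->
              res i = 1 / 2 * Num.sg (ustar i) &
            r + 1 / 4 < `|ustar i| -> res i = 0]].
Proof.
move=> res; have p_gt0 : 0 < p by lra.
have p_ge0 := ltW p_gt0; have r_ge0 := ltW r_gt0.
have prox i : prox_point (trunc_pow p r) (ustar i + res i) (ustar i).
  exact: min_coord_prox Tbounded (ltW Tnorm) p_gt0 _ ustar_min i.
have res0 i : r <= `|ustar i| -> res i = 0.
  move=> ru; have := prox_trunc_pow_ge p_ge0 r_ge0 ru (prox i).
  by rewrite -[RHS]addr0 => /addrI.
have proxp i : `|ustar i| <= r ->
    prox_point (fun y => `|y| `^ p) (ustar i + res i) (ustar i).
  by move=> ur; exact: prox_trunc_pow_le p_ge0 ur (prox i).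
have resE i : `|ustar i| <= r -> ustar i != 0 ->
    res i = Fp p (ustar i) - ustar i.
  by move=> ur u0; rewrite -(prox_pow_neq0 u0 (proxp i ur)) addrAC subrr add0r.
split.
- move=> i ru; have [p1|p1] := eqVneq p 1.
    have r14 := r_ge14 p1.
    (* For [t = r - 1/4] and [l = r + 1/4] the threshold equation reads [1/4 + (r - 1/4) = r];
       [r >= 1/4] gives [t >= 0]. *)
    apply: (@prox_trunc_pow_gap _ p r _ _ (r - 1 / 4)) (prox i) => //; try lra.
    by rewrite /lambda p1 eqxx !powRr1 ?subr_ge0//; field.
  have {}p1 : 1 < p by rewrite lt_neqAle eq_sym p1.
  apply: (prox_trunc_pow_gap p_ge0 _ _ (lambda_eqE p1 r_gt0) ru (prox i)).
    exact/ltW/Fp_inv_lambda_gt0.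
  exact/ltW/Fp_inv_lambda_lt.
- by move=> p1 i ur; apply: prox_trunc_pow_le_inv (prox i).
- move=> p1 i; have [/andP[rl _] _ _ _] := lambdaP r_gt0 p1; split.
    by move=> lu; apply: res0; rewrite (le_trans (ltW rl)).
  rewrite /delta subKr => ut.
  have ur : `|ustar i| <= r by rewrite (le_trans ut)// ltW// Fp_inv_lambda_lt.
  by rewrite -(prox_pow p1 (proxp i ur)) addrAC subrr add0r.
- move=> p1 i; have r14 := r_ge14 p1.
  have resh : `|ustar i| <= r -> ustar i != 0 ->
      res i = 1 / 2 * Num.sg (ustar i).
    move=> ur u0; rewrite resE// /Fp p1 subrr powRr0; ring.
  split.
  (* Since [r] may lie below [1/2], the truncated range has to be treated here too. *)
  + move=> _; have [ru|/ltW ur] := leP r `|ustar i|.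
      by rewrite res0//; lra.
    have [u0|u0] := eqVneq (ustar i) 0; last first.
      rewrite resh//; case: sgrP => _; lra.
    have := proxp i ur; rewrite u0 add0r => zx.
    rewrite -ler_norml; apply/ler_addgt0Pr => e e0.
    (* At [p = 1] the competitor [2 e] gives [2 |res i| <= 2 e + 1], that is
       [|res i| <= 1/2 + e]. *)
    have e2 : 0 < e * 2 by lra.
    have := prox_pow_at0 p_ge1 e2 zx.
    by rewrite p1 subrr powRr0; lra.
  + move=> /andP[u2 ur]; apply: resh; first by lra.
    by rewrite -normr_gt0; lra.
  + by move=> ru; apply: res0; lra.
Qed.
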